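(* Let $0\le K<N$ be integers and let $S$ be a 2-string with $|S|=2K$. Let $\bm{u}=(u_1,\dots,u_{N-K})$, let $\bm{u}\cup\bm{z}=(u_1,\dots,u_{N-K},z_1,z_2,\dots)$, and let $2^{N-K}\cup S=(2,\dots,2,S_1,S_2,\dots)$ with $N-K$ initial twos. Then, for an arbitrary choice of the alphabet $(w_1,\dots,w_{N-K})$, $$\lim_{u_1\to\infty}\cdots\lim_{u_{N-K}\to\infty}\frac{F_{2^{N-K}\cup S}(x_1,\dots,x_N;\bm{u}\cup\bm{z})}{F_{(2^{N-K})}(w_1,\dots,w_{N-K};\bm{u})}=H_S(x_1,\dots,x_N;\bm{z}).$$
   Context: **Weights.** All parameters ($q$ and the spectral parameters) are generic/indeterminates. For $i,j,k,\ell\in\{0,1,2\}$ the Izergin--Korepin vertex weight $W_{y/x}(i,j;k,\ell)$ ($i$ = bottom incoming state, $j$ = left incoming state, $k$ = top outgoing state, $\ell$ = right outgoing state; $x$ = parameter of the horizontal line, $y$ = parameter of the vertical line) depends on $x,y$ only through $y/x$, and, with $D=(x-q^2y)(x-q^3y)$, is given by $W(0,0;0,0)=W(2,2;2,2)=1$; $W(1,0;1,0)=W(2,1;2,1)=\frac{q^2(x-y)}{x-q^2y}$; $W(1,0;0,1)=W(2,1;1,2)=\frac{(1-q^2)x}{x-q^2y}$; $W(0,1;1,0)=W(1,2;2,1)=\frac{(1-q^2)y}{x-q^2y}$; $W(0,1;0,1)=W(1,2;1,2)=\frac{x-y}{x-q^2y}$; $W(2,0;2,0)=\frac{q^4(x-y)(x-qy)}{D}$;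 $W(2,0;1,1)=-\frac{q(1-q)^2(1+q)x(x-y)}{D}$; $W(2,0;0,2)=\frac{(1-q^2)x(x+qx-qy-q^3y)}{D}$; $W(1,1;2,0)=-\frac{q^4(1+q)(x-y)y}{D}$; $W(1,1;1,1)=\frac{-qx^2+(1+q)(1-q^2+q^4)xy-q^4y^2}{D}$; $W(1,1;0,2)=\frac{(1+q)x(x-y)}{D}$; $W(0,2;2,0)=\frac{(1-q^2)(x+q^2x-q^2y-q^3y)y}{D}$; $W(0,2;1,1)=\frac{q(1-q)^2(1+q)(x-y)y}{D}$; $W(0,2;0,2)=\frac{(x-y)(x-qy)}{D}$; and $W=0$ in all other cases. **2-strings.** A 2-string is an infinite vector $S=(S_1,S_2,\dots)$ with $S_i\in\{0,1,2\}$ and only finitely many nonzero entries; $|S|=\sum_i S_i$. Trailing zeros may be dropped; $(2^n)$ denotes $n$ twos followed by zeros. $\bm{z}=(z_1,z_2,\dots)$. **$F_S^I$ and $F_S$.** For $I=(I_1,\dots,I_N)\in\{0,1,2\}^N$ with $|I|=\sum_r I_r=|S|$, choose $L$ with $S_c=0$ for $c>L$ and put $$F_S^I(x_1,\dots,x_N;\bm{z})=\sum\prod_{r=1}^{N}\prod_{c=1}^{L}W_{z_c/x_r}(v_{r-1,c},h_{r,c-1};v_{r,c},h_{r,c}),$$ summed over all $h_{r,c}\in\{0,1,2\}$ ($1\le r\le N$, $0\le c\le L$) and $v_{r,c}\in\{0,1,2\}$ ($0\le r\le N$, $1\le c\le L$) with $h_{r,0}=I_r$, $h_{r,L}=0$,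 $v_{0,c}=0$, $v_{N,c}=S_c$ (independent of $L$; it depends only on $z_1,\dots,z_L$). For $|S|=2N$, $F_S:=F_S^{(2^N)}$. **$H_S$.** For $0\le K\le N$ and $|S|=2K$, $$H_S(x_1,\dots,x_N;\bm{z})=\sum_{I\in\{0,1,2\}^N:\,|I|=2K}(-1)^{\mathfrak{c}_1(I)/2}(1-q^{-1})^{\mathfrak{c}_1(I)}q^{-\mathrm{inv}(I)}F_S^I(x_1,\dots,x_N;\bm{z}),$$ where $\mathfrak{c}_1(I)=\#\{r:I_r=1\}$ and $\mathrm{inv}(I)=\sum_{1\le i<j\le N}I_i(2-I_j)$. *)

(* Defs.v *)
From HB Require Import structures.
From mathcomp Require Import all_boot all_order all_algebra finmap.
From mathcomp Require Import boolp classical_sets functions reals topology normedtype.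

Set Implicit Arguments.
Unset Strict Implicit.
Unset Printing Implicit Defensive.

Import Order.TTheory GRing.Theory Num.Theory.
Import numFieldNormedType.Exports.

Local Open Scope classical_set_scope.
Local Open Scope ring_scope.

(* The weight W_{y/x}(i, j; k, l): i is the bottom, j the left, k the top and  *)
(* l the right state; x belongs to the row and y to the column.                *)
Definition ik_weight (C : fieldType) (q x y : C) (i j k l : nat) : C :=
  let D := (x - q ^+ 2 * y) * (x - q ^+ 3 * y) in
  match i, j, k, l with
  | 0, 0, 0, 0 | 2, 2, 2, 2 => 1
  | 1, 0, 1, 0 | 2, 1, 2, 1 => q ^+ 2 * (x - y) / (x - q ^+ 2 * y)
  | 1, 0, 0, 1 | 2, 1, 1, 2 => (1 - q ^+ 2) * x / (x - q ^+ 2 * y)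
  | 0, 1, 1, 0 | 1, 2, 2, 1 => (1 - q ^+ 2) * y / (x - q ^+ 2 * y)
  | 0, 1, 0, 1 | 1, 2, 1, 2 => (x - y) / (x - q ^+ 2 * y)
  | 2, 0, 2, 0 => q ^+ 4 * (x - y) * (x - q * y) / D
  | 2, 0, 1, 1 => - (q * (1 - q) ^+ 2 * (1 + q) * x * (x - y) / D)
  | 2, 0, 0, 2 => (1 - q ^+ 2) * x * (x + q * x - q * y - q ^+ 3 * y) / D
  | 1, 1, 2, 0 => - (q ^+ 4 * (1 + q) * (x - y) * y / D)
  | 1, 1, 1, 1 =>
      (- (q * x ^+ 2) + (1 + q) * (1 - q ^+ 2 + q ^+ 4) * x * y
       - q ^+ 4 * y ^+ 2) / D
  | 1, 1, 0, 2 => (1 + q) * x * (x - y) / D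
  | 0, 2, 2, 0 =>
      (1 - q ^+ 2) * (x + q ^+ 2 * x - q ^+ 2 * y - q ^+ 3 * y) * y / D
  | 0, 2, 1, 1 => q * (1 - q) ^+ 2 * (1 + q) * (x - y) * y / D
  | 0, 2, 0, 2 => (x - y) * (x - q * y) / D
  | _, _, _, _ => 0
  end.

(* All indices are shifted to start at 0: S c stands for S_{c+1}.              *)
Notation two_string := {fsfun nat -> 'I_3 with ord0}.

(* The least L with S_c = 0 for all c > L.                                     *)
Definition str_len (S : two_string) : nat := (\max_(c <- finsupp S) c.+1)%N.

Definition str_weight (S : two_string) : nat := (\sum_(c <- finsupp S) S c)%N.

Definition cat_twos (n : nat) (S : two_string) : two_string :=
  [fsfun c in seq_fset tt (iota 0 (n + str_len S)) =>
     if (c < n)%N then ord_max else S (c - n)%N | ord0].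

Definition empty_string : two_string := [fsfun with ord0].

Definition cat_alphabet (C : Type) (n : nat) (u : n.-tuple C) (z : nat -> C) :
    nat -> C :=
  fun c => nth (z (c - n)%N) u c.

(* h r c is the state of the horizontal edge of row r to the left of column c  *)
(* (to the right of the last column if c = L); v r c is the state of the       *)
(* vertical edge of column c below row r (above the last row if r = N).        *)
Definition partition_fun (C : fieldType) (q : C) (N : nat) (I : 'I_N -> 'I_3)
    (S : two_string) (x : 'I_N -> C) (z : nat -> C) : C :=
  let L := str_len S in
  \sum_(h : 'M['I_3]_(N, L.+1) |
          [forall r, (h r ord0 == I r) && (h r ord_max == ord0)])
  \sum_(v : 'M['I_3]_(N.+1, L) |
          [forall c, (v ord0 c == ord0) && (v ord_max c == S c)])
  \prod_(r < N) \prod_(c < L)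
    ik_weight q (x r) (z c)
      (v (widen_ord (leqnSn N) r) c) (h r (widen_ord (leqnSn L) c))
      (v (lift ord0 r) c) (h r (lift ord0 c)).

(* F_S, meant for |S| = 2 N.                                                   *)
Definition F_fun (C : fieldType) (q : C) (N : nat) (S : two_string)
    (x : 'I_N -> C) (z : nat -> C) : C :=
  partition_fun q (fun=> ord_max) S x z.

Definition count_ones (N : nat) (I : 'I_N -> 'I_3) : nat :=
  (\sum_(r < N) (I r == 1 :> nat))%N.

Definition inversions (N : nat) (I : 'I_N -> 'I_3) : nat :=
  (\sum_(i < N) \sum_(j < N | i < j) I i * (2 - I j))%N.

(* H_S, meant for |S| even and at most 2 N; count_ones I is then even for      *)
(* every I in the sum.                                                         *)
Definition H_fun (C : fieldType) (q : C) (N : nat) (S : two_string)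
    (x : 'I_N -> C) (z : nat -> C) : C :=
  \sum_(I : {ffun 'I_N -> 'I_3} | (\sum_(r < N) I r == str_weight S)%N)
    (-1) ^+ (count_ones I)./2 * (1 - q^-1) ^+ count_ones I
      * q ^- inversions I * partition_fun q I S x z.

(* Neighbourhoods of the point at infinity, i.e. `|u| -> +oo. Without the      *)
(* reality condition the bound could be a non-real M, for which M < `|u| never *)
(* holds.                                                                      *)
Definition infty_nbhs (C : numFieldType) : set_system C :=
  [set P | exists M : C, M \is Num.real /\ forall u : C, M < `|u| -> P u].

Global Instance infty_nbhs_properfilter (C : numFieldType) :
  ProperFilter (@infty_nbhs C).
Proof.
split.
  move=> [M [Mreal /(_ (`|M| + 1))]]; apply.
  rewrite ger0_norm ?addr_ge0 //.
  by rewrite (le_lt_trans (real_ler_norm Mreal)) // ltrDl ltr01.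
split.
- by exists 0; split=> //; rewrite real0.
- move=> P Q [M [Mreal MP]] [M' [M'real MQ]].
  exists (`|M| + `|M'|); split; first by rewrite realD ?normr_real.
  move=> u lt_u; split.
    by apply: MP; apply: le_lt_trans lt_u; rewrite ler_wpDr // real_ler_norm.
  by apply: MQ; apply: le_lt_trans lt_u; rewrite ler_wpDl // real_ler_norm.
- move=> P Q PQ [M [Mreal MP]]; exists M; split=> // u Mu.
  by apply: PQ; apply: MP.
Qed.

(* lim_{u_1 -> oo} ... lim_{u_n -> oo} f(u_1, ..., u_n) exists and equals l;   *)
(* the limit in u_n is the innermost one. The inner limits, collected in g,    *)
(* are required to exist for u_1 in a neighbourhood of infinity.               *)
Fixpoint iterated_lim_infty (C : numFieldType) (n : nat) :
    (n.-tuple C -> C) -> C -> Prop :=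
  match n with
  | 0 => fun f l => f [tuple] = l
  | n'.+1 => fun f l => exists g : C -> C,
      (\forall u1 \near @infty_nbhs C,
         iterated_lim_infty (fun u : n'.-tuple C => f [tuple of u1 :: u]) (g u1))
      /\ g u1 @[u1 --> @infty_nbhs C] --> l
  end.

(* Main.v *)
Require Import Defs.
From HB Require Import structures.
From mathcomp Require Import all_boot all_order all_algebra finmap.
From mathcomp Require Import boolp classical_sets functions reals topology normedtype.
From mathcomp Require Import ring zify.

Set Implicit Arguments.
Unset Strict Implicit.
Unset Printing Implicit Defensive.

Import Order.TTheory GRing.Theory Num.Theory.
Import numFieldNormedType.Exports.

Local Open Scope classical_set_scope.
Local Open Scope ring_scope.

(** Let p = q^-1. As the parameter of a column tends to infinity, every vertex
weight tends to its value at (x, y) = (0, 1), which no longer depends on the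
parameter of the row ([cvg_ik_weight]). Iterated limits at infinity commute with
sums, with products and with inverses of functions whose limit is nonzero
([iterated_limD], [iterated_limM], [iterated_limV]), so the limit of
F_(2^n u S), where n = N - K, is the partition function in which the first n
columns carry the limit weights. These columns act as a power of one matrix T,
where T(J, I) is the partition function of a single column with left states J,
right states I, bottom state 0 and top state 2.

The coefficients f(I) of H_S behave like an eigenvector of T with an eigenvalue
that depends on the degree: for |I| = t even,

  sum_J f(J) T(J, I) = (1 - e) (1 + q e) f(I),   e = (-q)^t p^(2N).

This is the case s = 2 of [sum_h_coef_inf_column], which treats a column with
an arbitrary top state s and is proved by induction on the number N of rows:
f(J) is a product over the rows r of factors depending only on J_r and on
J_1 + ... + J_(r-1) ([h_coefS]), and the latter sum is determined by I and by
the vertical state below row r, since states are conserved at each vertex.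

Since f is 1 on (2^N), the n columns turn the left boundary (2^N) into Lambda_n
times the restriction of f to |I| = 2K ([path_sum_inf_column]), where

  Lambda_n = prod_(1 <= j <= n) (1 - p^(2j)) (1 + p^(2j-1)).

This number does not depend on N. Hence F_(2^n u S) tends to Lambda_n H_S, and
F_(2^n)(w; u), which is the same quantity for n rows and S empty, tends to
Lambda_n. As q is not a root of unity, Lambda_n is not 0, and the quotient tends
to H_S. *)

(** * Path sums *)

(** The function on n + 1 points that extends f by the value a at the last. *)
Definition ffun_rcons (T : Type) n (f : {ffun 'I_n -> T}) (a : T) :
    {ffun 'I_n.+1 -> T} :=
  [ffun i => if unlift ord_max i is Some j then f j else a].

Lemma ffun_rcons_max (T : Type) n (f : {ffun 'I_n -> T}) (a : T) :
  ffun_rcons f a ord_max = a.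
Proof. by rewrite ffunE unlift_none. Qed.

Lemma ffun_rcons_widen (T : Type) n (f : {ffun 'I_n -> T}) (a : T) i :
  ffun_rcons f a (widen_ord (leqnSn n) i) = f i.
Proof.
rewrite ffunE (_ : widen_ord _ i = lift ord_max i) ?liftK //.
by apply: val_inj; exact: esym (lift_max i).
Qed.

Lemma sum_ffun_recr (R : nmodType) (T : finType) n
    (F : {ffun 'I_n.+1 -> T} -> R) :
  \sum_f F f = \sum_(f : {ffun 'I_n -> T}) \sum_a F (ffun_rcons f a).
Proof.
rewrite pair_big /= (reindex (fun u => ffun_rcons u.1 u.2)) //.
exists (fun f : {ffun _} =>
          ([ffun i => f (widen_ord (leqnSn n) i)], f ord_max)).
  move=> [f a] _ /=; rewrite ffun_rcons_max; congr (_, _).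
  by apply/ffunP => i; rewrite ffunE ffun_rcons_widen.
move=> f _; apply/ffunP => i /=; rewrite ffunE; case: unliftP => [j|] -> //.
by rewrite ffunE; congr (f _); apply: val_inj; exact: esym (lift_max j).
Qed.

(** The weighted count of the paths v_0, ..., v_n from a to b in T, in which the
r-th step from c to d has weight M r c d. This is the (a, b) entry of the
product of the matrices M r. *)
Definition path_sum (C : comPzSemiRingType) (T : finType) n
    (M : 'I_n -> T -> T -> C) (a b : T) : C :=
  \sum_(v : {ffun 'I_n.+1 -> T} | (v ord0 == a) && (v ord_max == b))
    \prod_(r < n) M r (v (widen_ord (leqnSn n) r)) (v (lift ord0 r)).

Lemma path_sum0 (C : comPzSemiRingType) (T : finType)
    (M : 'I_0 -> T -> T -> C) a b :
  path_sum M a b = (a == b)%:R.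
Proof.
rewrite /path_sum big_mkcond /= sum_ffun_recr.
rewrite (bigD1 [ffun=> a]) //= [X in _ + X]big1 ?addr0; last first.
  by move=> f /eqP[]; apply/ffunP => -[].
rewrite (bigD1 a) //= [X in _ + X]big1 ?addr0; last first.
  move=> c /negbTE ca; have -> : ord0 = ord_max :> 'I_1 by exact: val_inj.
  by rewrite ffun_rcons_max ca.
have -> : ord0 = ord_max :> 'I_1 by exact: val_inj.
by rewrite ffun_rcons_max eqxx big_ord0; case: (a == b).
Qed.

Lemma path_sumS (C : comPzSemiRingType) (T : finType) n
    (M : 'I_n.+1 -> T -> T -> C) a b :
  path_sum M a b =
  \sum_c path_sum (fun r => M (widen_ord (leqnSn n) r)) a c * M ord_max c b.
Proof.
rewrite /path_sum big_mkcond /= sum_ffun_recr.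
under eq_bigr => c _ do rewrite big_distrl /= big_mkcond /=.
rewrite [RHS]exchange_big /=; apply: eq_bigr => f _.
have E0 d : ffun_rcons f d ord0 = f ord0.
  rewrite -[in RHS](ffun_rcons_widen f d); congr (ffun_rcons f d _).
  exact: val_inj.
rewrite (bigD1 b) //= [X in _ + X]big1 ?addr0; last first.
  by move=> d /negbTE db; rewrite ffun_rcons_max db andbF.
rewrite (bigD1 (f ord_max)) //= [X in _ = _ + X]big1 ?addr0; last first.
  by move=> d dmax; rewrite [_ == d]eq_sym (negbTE dmax) andbF.
rewrite E0 ffun_rcons_max !eqxx !andbT; case: ifP => // _.
rewrite big_ord_recr /=; congr (_ * M _ _ _); last 2 first.
- by rewrite ffun_rcons_widen.
- rewrite (_ : lift _ _ = ord_max) ?ffun_rcons_max //; exact: val_inj.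
apply: eq_bigr => r _; rewrite ffun_rcons_widen; congr (M _ _ _).
rewrite (_ : lift _ _ = widen_ord (leqnSn n.+1) (lift ord0 r)).
  by rewrite ffun_rcons_widen.
exact: val_inj.
Qed.

Lemma path_sum_cat (C : comPzSemiRingType) (T : finType) n L
    (M : nat -> T -> T -> C) a b :
  path_sum (fun r : 'I_(n + L) => M r) a b =
  \sum_c path_sum (fun r : 'I_n => M r) a c *
         path_sum (fun r : 'I_L => M (n + r)%N) c b.
Proof.
elim: L b => [|L IHL] b.
  rewrite addn0 (bigD1 b) //= [X in _ + X]big1 ?addr0; last first.
    by move=> c /negbTE cb; rewrite path_sum0 cb mulr0.
  by rewrite path_sum0 eqxx mulr1.
rewrite addnS path_sumS.
under eq_bigr => c _ do rewrite /= IHL big_distrl /=.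
rewrite exchange_big /=; apply: eq_bigr => d _.
rewrite path_sumS big_distrr /=; apply: eq_bigr => c _.
by rewrite mulrA.
Qed.

Lemma eq_path_sum (C : comPzSemiRingType) (T : finType) n
    (M M' : 'I_n -> T -> T -> C) a b :
  (forall r c d, M r c d = M' r c d) -> path_sum M a b = path_sum M' a b.
Proof.
by move=> eqM; apply: eq_bigr => v _; apply: eq_bigr => r _; rewrite eqM.
Qed.

(** The partition function of one column with vertex weights w, bottom state 0,
top state s, left states J and right states I. *)
Definition column_sum (C : comPzSemiRingType) N
    (w : 'I_N -> nat -> nat -> nat -> nat -> C) (s : 'I_3)
    (J I : {ffun 'I_N -> 'I_3}) : C :=
  path_sum (fun r (a b : 'I_3) => w r a (J r) b (I r)) ord0 s.

(** * The partition function as a path sum *)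

(** The matrix with columns f j. *)
Definition matrix_of_cols (T : Type) m n (f : {ffun 'I_n -> {ffun 'I_m -> T}}) :
  'M[T]_(m, n) := \matrix_(i, j) f j i.

Lemma sum_matrix_cols (R : nmodType) (T : finType) m n (P : pred 'M[T]_(m, n))
    (F : 'M[T]_(m, n) -> R) :
  \sum_(A | P A) F A =
  \sum_(f : {ffun 'I_n -> {ffun 'I_m -> T}} | P (matrix_of_cols f))
     F (matrix_of_cols f).
Proof.
rewrite (reindex (@matrix_of_cols T m n)) //.
exists (fun A : 'M[T]_(m, n) => [ffun j => [ffun i => A i j]]).
  by move=> f _; apply/ffunP => j; apply/ffunP => i; rewrite !ffunE mxE.
by move=> A _; apply/matrixP => i j; rewrite mxE !ffunE.
Qed.

(** Summing the vertical states column by column turns the partition function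
into a path sum over the sequences of horizontal states between the columns. *)
Lemma partition_fun_path_sum (C : fieldType) (q : C) N (I : 'I_N -> 'I_3)
    (S : two_string) (x : 'I_N -> C) (z : nat -> C) :
  partition_fun q I S x z =
  path_sum (fun c : 'I_(str_len S) =>
              column_sum (fun r => ik_weight q (x r) (z c)) (S c))
    (finfun I) [ffun=> ord0].
Proof.
rewrite /partition_fun; set L := str_len S.
rewrite sum_matrix_cols /path_sum; apply: eq_big => [h|h _].
  apply/forallP/andP => [hP|[/eqP h0 /eqP h1] r]; last first.
    by rewrite !mxE h0 h1 !ffunE !eqxx.
  split; apply/eqP/ffunP => r; have := hP r; rewrite !mxE !ffunE.
    by case/andP=> /eqP.
  by case/andP=> _ /eqP.
rewrite sum_matrix_cols /column_sum /path_sum bigA_distr_big_dep /=.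
apply: eq_big => [v|v _].
  by apply/forallP/familyP => vP c; have := vP c; rewrite !mxE.
rewrite exchange_big /=; apply: eq_bigr => c _; apply: eq_bigr => r _.
by rewrite !mxE.
Qed.

Lemma str_len_leqP (S : two_string) m :
  reflect (forall c, (m <= c)%N -> S c = ord0) (str_len S <= m)%N.
Proof.
apply: (iffP (bigmax_leqP_seq _ _ _ _)) => [leS c lemc|S0 c cS _].
  apply/eqP; apply: contraLR lemc => Sc.
  by rewrite -ltnNge; apply: leS => //; rewrite mem_finsupp.
rewrite ltnNge; apply: contraL cS => /S0 Sc.
by rewrite mem_finsupp Sc eqxx.
Qed.

(** Beyond the explicit support both sides vanish: no bound on c is needed. *)
Lemma cat_twosE n (S : two_string) c :
  cat_twos n S c = if (c < n)%N then ord_max else S (c - n)%N.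
Proof.
rewrite fsfunE seq_fsetE mem_iota add0n /=.
case: (ltnP c (n + str_len S)) => // lec.
rewrite ltnNge (leq_trans (leq_addr _ _) lec) /=.
have /str_len_leqP -> // := leqnn (str_len S).
by rewrite leq_subRL // (leq_trans (leq_addr _ _) lec).
Qed.

Lemma str_len_cat_twos n (S : two_string) :
  str_len (cat_twos n S) = (n + str_len S)%N.
Proof.
apply/eqP; rewrite eqn_leq; apply/andP; split.
  apply/str_len_leqP => c lec; rewrite cat_twosE ltnNge.
  rewrite (leq_trans (leq_addr _ _) lec) /=.
  have /str_len_leqP -> // := leqnn (str_len S).
  by rewrite leq_subRL // (leq_trans (leq_addr _ _) lec).
have /str_len_leqP T0 := leqnn (str_len (cat_twos n S)).
set m := str_len _ in T0 *.
have lenm : (n <= m)%N.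
  case: (posnP n) => [-> //|n_gt0].
  rewrite leqNgt; apply/negP => ltmn; have := T0 n.-1; rewrite cat_twosE.
  rewrite prednK // leqnn => /(_ _)/(congr1 val) /=.
  by move=> T0n; have /T0n : (m <= n.-1)%N by rewrite -ltnS prednK.
rewrite -leq_subRL //; apply/str_len_leqP => c lec.
have := T0 (n + c)%N; rewrite cat_twosE ltnNge leq_addr /= addKn; apply.
by rewrite -leq_subLR.
Qed.

Lemma str_len_empty : str_len empty_string = 0%N.
Proof.
by apply/eqP; rewrite -leqn0; apply/str_len_leqP => c _; rewrite fsfun0E.
Qed.

Lemma str_weight_empty : str_weight empty_string = 0%N.
Proof. by rewrite /str_weight finsupp0 big_seq_fset0. Qed.

(** * Iterated limits at infinity *)

Lemma iterated_lim_cst (C : numFieldType) n (c : C) :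
  iterated_lim_infty (fun _ : n.-tuple C => c) c.
Proof.
elim: n => [//|n IHn] /=; exists (fun=> c); split; last exact: cvg_cst.
by apply: nearW => u1; exact: IHn.
Qed.

Lemma iterated_limD (C : numFieldType) n (f1 f2 : n.-tuple C -> C) l1 l2 :
  iterated_lim_infty f1 l1 -> iterated_lim_infty f2 l2 ->
  iterated_lim_infty (fun u => f1 u + f2 u) (l1 + l2).
Proof.
elim: n f1 f2 l1 l2 => [|n IHn] f1 f2 l1 l2 /=; first by move=> -> ->.
move=> [g1 [lim1 cvg1]] [g2 [lim2 cvg2]]; exists (fun u => g1 u + g2 u).
by split; [apply: filterS2 lim1 lim2 => u1; exact: IHn | exact: cvgD].
Qed.

Lemma iterated_limM (C : numFieldType) n (f1 f2 : n.-tuple C -> C) l1 l2 :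
  iterated_lim_infty f1 l1 -> iterated_lim_infty f2 l2 ->
  iterated_lim_infty (fun u => f1 u * f2 u) (l1 * l2).
Proof.
elim: n f1 f2 l1 l2 => [|n IHn] f1 f2 l1 l2 /=; first by move=> -> ->.
move=> [g1 [lim1 cvg1]] [g2 [lim2 cvg2]]; exists (fun u => g1 u * g2 u).
by split; [apply: filterS2 lim1 lim2 => u1; exact: IHn | exact: cvgM].
Qed.

Lemma iterated_limV (C : numFieldType) n (f : n.-tuple C -> C) l :
  l != 0 -> iterated_lim_infty f l ->
  iterated_lim_infty (fun u => (f u)^-1) l^-1.
Proof.
elim: n f l => [|n IHn] f l l_neq0 /=; first by move=> ->.
move=> [g [limg cvgg]]; exists (fun u => (g u)^-1); split; last exact: cvgV.
have g_neq0 : \forall u1 \near @infty_nbhs C, g u1 != 0.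
  exact: cvgr_neq0 cvgg l_neq0.
by apply: filterS2 g_neq0 limg => u1; exact: IHn.
Qed.

(** Any operation compatible with iterated limits remains so when iterated over
a finite range. *)
Lemma iterated_lim_big (C : numFieldType) n (T : Type) (r : seq T) (P : pred T)
    (op : C -> C -> C) (idx : C) (f : T -> n.-tuple C -> C) (l : T -> C) :
  (forall (f1 f2 : n.-tuple C -> C) l1 l2,
     iterated_lim_infty f1 l1 -> iterated_lim_infty f2 l2 ->
     iterated_lim_infty (fun u => op (f1 u) (f2 u)) (op l1 l2)) ->
  (forall i, P i -> iterated_lim_infty (f i) (l i)) ->
  iterated_lim_infty (fun u => \big[op/idx]_(i <- r | P i) f i u)
    (\big[op/idx]_(i <- r | P i) l i).
Proof.
move=> lim_op fl; elim: r => [|i r IHr].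
  rewrite big_nil (_ : (fun _ => _) = fun=> idx); first exact: iterated_lim_cst.
  by apply/funext => u; rewrite big_nil.
rewrite big_cons (_ : (fun _ => _) = fun u =>
  if P i then op (f i u) (\big[op/idx]_(j <- r | P j) f j u)
  else \big[op/idx]_(j <- r | P j) f j u); last first.
  by apply/funext => u; rewrite big_cons.
by case: ifP => // Pi; exact: lim_op (fl _ Pi) IHr.
Qed.

(** A function of a single variable u_c: all the other limits are limits of
constants. *)
Lemma iterated_lim_nth (C : numFieldType) n (c : nat) (phi : C -> C) (l d : C) :
  (c < n)%N -> phi y @[y --> @infty_nbhs C] --> l ->
  iterated_lim_infty (fun u : n.-tuple C => phi (nth d u c)) l.
Proof.
elim: n c => [//|n IHn] [|c] /= ltcn phil.
  exists phi; split=> //; apply: nearW => u1; exact: iterated_lim_cst.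
exists (fun=> l); split; last exact: cvg_cst.
by apply: nearW => u1; exact: IHn.
Qed.

(** * Limits of the vertex weights *)

Lemma cvg_inv_infty (C : numFieldType) :
  y^-1 @[y --> @infty_nbhs C] --> (0 : C).
Proof.
apply/cvgrPdist_lt => e e_gt0; exists e^-1; split.
  by rewrite realV gtr0_real.
move=> y lty; have y_gt0 : 0 < `|y| by apply: lt_trans lty; rewrite invr_gt0.
by rewrite sub0r normrN normfV invf_plt ?posrE.
Qed.

(** The weight depends on x and y only through y / x. *)
Lemma ik_weight_homog (C : fieldType) (q x y a : C) (i j k l : nat) :
  a != 0 -> ik_weight q (x * a) (y * a) i j k l = ik_weight q x y i j k l.
Proof.
move=> a_neq0.
have frac1 (s t s' t' : C) : s' = s * a -> t' = t * a -> s' / t' = s / t.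
  by move=> -> ->; rewrite -mulf_div divff ?mulr1.
have frac2 (s t s' t' : C) :
  s' = s * (a * a) -> t' = t * (a * a) -> s' / t' = s / t.
  by move=> -> ->; rewrite -mulf_div divff ?mulr1 // mulf_neq0.
by move: i j k l => [|[|[|i]]] [|[|[|j]]] [|[|[|k]]] [|[|[|l]]] //=;
  try (congr (- _));
  first [apply: frac1; ring | apply: frac2; ring].
Qed.

(** The weight is a rational function of x. It is therefore compatible with
every notion of limit that respects the field operations. *)
Lemma ik_weight_closed (C : fieldType) (T : Type) (lim : (T -> C) -> C -> Prop)
    (lim_cst : forall c, lim (fun=> c) c)
    (limD : forall f g a b, lim f a -> lim g b ->
       lim (fun u => f u + g u) (a + b))
    (limN : forall f a, lim f a -> lim (fun u => - f u) (- a))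
    (limM : forall f g a b, lim f a -> lim g b ->
       lim (fun u => f u * g u) (a * b))
    (limV : forall f a, a != 0 -> lim f a -> lim (fun u => (f u)^-1) a^-1)
    (q x y : C) (f : T -> C) (i j k l : nat) :
  x - q ^+ 2 * y != 0 -> x - q ^+ 3 * y != 0 -> lim f x ->
  lim (fun u => ik_weight q (f u) y i j k l) (ik_weight q x y i j k l).
Proof.
have limX2 g a : lim g a -> lim (fun u => g u ^+ 2) (a ^+ 2).
  by move=> lim_g; exact: (limM _ _ _ _ lim_g lim_g).
move=> D2 D3 limf.
move: i j k l => [|[|[|i]]] [|[|[|j]]] [|[|[|k]]] [|[|[|l]]] /=;
  (* Parentheses keep the closure hypotheses in the context for reuse. *)
  repeat first
    [ exact: (lim_cst) | exact: limf | apply: (limD) | apply: (limN)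
    | apply: (limX2) | apply: (limM)
    | apply: (limV); first by rewrite ?mulf_neq0].
Qed.

(** The limit is the weight at (x / y, 1) with x / y replaced by 0; there D does
not vanish. *)
Lemma cvg_ik_weight (C : numFieldType) (q x : C) (i j k l : nat) :
  q != 0 ->
  ik_weight q x y i j k l @[y --> @infty_nbhs C] --> ik_weight q 0 1 i j k l.
Proof.
move=> q_neq0.
suff cvgW : ik_weight q (x * y^-1) 1 i j k l @[y --> @infty_nbhs C]
    --> ik_weight q 0 1 i j k l.
  apply: cvg_trans cvgW; apply: near_eq_cvg; exists 0; split=> // y.
  rewrite normr_gt0 => y_neq0.
  by rewrite -[X in ik_weight q _ X](divff y_neq0) ik_weight_homog ?invr_neq0.
pose lim (f : C -> C) (l : C) := f y @[y --> @infty_nbhs C] --> l.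
refine (@ik_weight_closed C C lim _ _ _ _ _ q 0 1 (fun y => x * y^-1)
          i j k l _ _ _); rewrite /lim ?sub0r ?mulr1 ?oppr_eq0 ?expf_neq0 //.
- by move=> c; exact: cvg_cst.
- by move=> f g a b; exact: cvgD.
- by move=> f a; exact: cvgN.
- by move=> f g a b; exact: cvgM.
- by move=> f a; exact: cvgV.
- rewrite -[0](mulr0 x).
  by apply: cvgM; [exact: cvg_cst | exact: cvg_inv_infty].
Qed.

(** * Columns at infinity and the coefficients of H *)

(** |I|, the sum of the entries of I. *)
Definition total_state N (I : 'I_N -> 'I_3) : nat := \sum_(r < N) I r.

(** The coefficient f(I) of F_S^I in H_S. *)
Definition h_coef (C : fieldType) (q : C) N (I : 'I_N -> 'I_3) : C :=
  (-1) ^+ (count_ones I)./2 * (1 - q^-1) ^+ count_ones I * q ^- inversions I.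

(** The factor by which f(I) grows when the entry j is appended to I, where
t = |I|. The sign of h_coef appears here as (-1)^t for each entry 1 following
entries of sum t, since c_1(I) and |I| have the same parity. *)
Definition h_factor (C : fieldType) (q : C) (t : nat) (j : 'I_3) : C :=
  match val j with
  | 0 => q ^- (2 * t)
  | 1 => (-1) ^+ t * (1 - q^-1) * q ^- t
  | _ => 1
  end.

Lemma odd_count_ones N (I : 'I_N -> 'I_3) :
  odd (count_ones I) = odd (total_state I).
Proof.
rewrite /count_ones /total_state; elim/big_rec2: _ => // r m n _ mn.
by rewrite !oddD mn; case: (I r) => -[|[|[|]]].
Qed.

Lemma h_coefS (C : fieldType) (q : C) N (I : 'I_N.+1 -> 'I_3)
    (t := total_state (I \o widen_ord (leqnSn N))) :
  h_coef q I = h_coef q (I \o widen_ord (leqnSn N)) *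
    h_factor q t (I ord_max).
Proof.
have cE : count_ones I = (count_ones (I \o widen_ord (leqnSn N))
    + (I ord_max == 1 :> nat))%N by rewrite /count_ones big_ord_recr.
have iE : inversions I = (inversions (I \o widen_ord (leqnSn N))
    + t * (2 - I ord_max))%N.
  rewrite /inversions big_ord_recr /= [X in (_ + X)%N]big1 ?addn0; last first.
    by move=> j; rewrite ltnNge -ltnS ltn_ord.
  rewrite /t /total_state big_distrl -big_split /=; apply: eq_bigr => i _.
  by rewrite big_mkcond big_ord_recr /= ltn_ord -big_mkcond.
have oE := odd_count_ones (I \o widen_ord (leqnSn N)).
rewrite /h_coef /h_factor cE iE; set c := count_ones _ in oE *.
case: (I ord_max) => -[|[|[|//]]] lt_i /=.
- by rewrite addn0 subn0 exprD invfM !mulrA [(t * 2)%N]mulnC.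
- rewrite addn1 -uphalfE uphalf_half oE -/t exprD -(signr_odd _ t) exprS.
  rewrite muln1 exprD invfM.
  by ring.
- by rewrite addn0 subnn muln0 addn0 mulr1.
Qed.

(** The matrix of a column with parameter at infinity and top state s; it is T
for s = 2. *)
Definition inf_column (C : fieldType) (q : C) N (s : 'I_3)
    (J I : {ffun 'I_N -> 'I_3}) : C :=
  column_sum (fun=> ik_weight q 0 1) s J I.

(** Conservation of states at a vertex. *)
Lemma ik_weight_conserve (C : fieldType) (q x y : C) (i j k l : nat) :
  (i + j != k + l)%N -> ik_weight q x y i j k l = 0.
Proof.
by move: i j k l => [|[|[|i]]] [|[|[|j]]] [|[|[|k]]] [|[|[|l]]].
Qed.

Lemma inf_columnS (C : fieldType) (q : C) N (s : 'I_3)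
    (J I : {ffun 'I_N.+1 -> 'I_3}) :
  inf_column q s J I =
  \sum_b inf_column q b [ffun r => J (widen_ord (leqnSn N) r)]
           [ffun r => I (widen_ord (leqnSn N) r)]
         * ik_weight q 0 1 b (J ord_max) s (I ord_max).
Proof.
rewrite /inf_column /column_sum path_sumS; apply: eq_bigr => b _.
by congr (_ * _); apply: eq_path_sum => r c d; rewrite !ffunE.
Qed.

Lemma totalS N (I : {ffun 'I_N.+1 -> 'I_3}) :
  total_state I =
  (total_state [ffun r => I (widen_ord (leqnSn N) r)] + I ord_max)%N.
Proof.
rewrite /total_state big_ord_recr; congr addn.
by apply: eq_bigr => r _; rewrite ffunE.
Qed.

Lemma inf_column_conserve (C : fieldType) (q : C) N (s : 'I_3)
    (J I : {ffun 'I_N -> 'I_3}) :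
  (total_state J != total_state I + s)%N -> inf_column q s J I = 0.
Proof.
elim: N s J I => [|N IHN] s J I.
  rewrite /total_state !big_ord0 /inf_column /column_sum path_sum0 => s_neq0.
  by case: (eqVneq ord0 s) s_neq0 => // <-.
rewrite !totalS inf_columnS => neq_tot; apply: big1 => b _.
have [totb|] := eqVneq (total_state [ffun r => J (widen_ord (leqnSn N) r)])
  (total_state [ffun r => I (widen_ord (leqnSn N) r)] + b)%N; last first.
  by move=> /IHN ->; rewrite mul0r.
rewrite ik_weight_conserve ?mulr0 //; apply: contraNneq neq_tot => eq_b.
by rewrite totb -addnA eq_b; apply/eqP; lia.
Qed.

(** The scalar by which a column at infinity with top state s and N rows
multiplies f(I), where t = |I|. *)
Definition column_factor (C : fieldType) (q : C) (N t : nat) (s : 'I_3) : C :=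
  let e := (- q) ^+ t * q ^- (2 * N) in
  match val s with
  | 0 => q ^- (2 * t)
  | 1 => (1 - q^-1) * ((-1) ^+ t * q ^- t - q ^- (2 * N))
  | _ => (1 - e) * (1 + q * e)
  end.

(** By induction on the rows: splitting off the last one, the sum over the last
entry j of J and over the vertical state b below the last row reduces the claim
to a recursion for column_factor, which is checked in each of the nine cases
for (I_N, s). *)
Lemma sum_h_coef_inf_column (C : fieldType) (q : C) N (s : 'I_3)
    (I : {ffun 'I_N -> 'I_3}) : q != 0 ->
  \sum_(J : {ffun 'I_N -> 'I_3}) h_coef q J * inf_column q s J I =
  h_coef q I * column_factor q N (total_state I) s.
Proof.
move=> q_neq0; elim: N s I => [|N IHN] s I.
  rewrite (bigD1 I) //= big1 ?addr0; last first.
    by move=> J /eqP[]; apply/ffunP => -[].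
  congr (_ * _); rewrite /inf_column /column_sum path_sum0 /column_factor.
  rewrite /total_state big_ord0 muln0 !expr0 invr1.
  by case: s => -[|[|[|//]]] ?; rewrite -val_eqE /= ?mulr1 ?subrr ?mulr0 ?mul0r.
rewrite sum_ffun_recr.
set I' := [ffun r => I (widen_ord (leqnSn N) r)].
have eqI : I \o widen_ord (leqnSn N) =1 I' by move=> r; rewrite ffunE.
(* J runs over the functions ffun_rcons J j. *)
have gE J (j : 'I_3) :
    h_coef q (ffun_rcons J j) = h_coef q J * h_factor q (total_state J) j.
  rewrite h_coefS ffun_rcons_max (_ : _ \o _ = J) //.
  by apply/funext => r; rewrite /= ffun_rcons_widen.
have stepE J (j : 'I_3) :
    h_coef q (ffun_rcons J j) * inf_column q s (ffun_rcons J j) I =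
    \sum_b h_coef q J * inf_column q b J I' *
      (h_factor q (total_state I' + b) j * ik_weight q 0 1 b j s (I ord_max)).
  rewrite gE inf_columnS ffun_rcons_max big_distrr; apply: eq_bigr => b _ /=.
  rewrite -/I' (_ : [ffun r => _] = J); last first.
    by apply/ffunP => r; rewrite ffunE ffun_rcons_widen.
  (* |J| may be replaced by |I'| + b wherever the column does not vanish. *)
  have [-> |/inf_column_conserve ->] :=
    eqVneq (total_state J) (total_state I' + b)%N.
    by ring.
  by rewrite !(mulr0, mul0r).
under eq_bigr => J _ do under eq_bigr => j _ do rewrite stepE.
rewrite exchange_big; under eq_bigr => j _ do rewrite exchange_big /=.
under eq_bigr => j _ do under eq_bigr => b _ do
  rewrite -mulr_suml IHN -mulrA.
rewrite h_coefS (_ : I \o _ = I'); last exact/funext.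
under eq_bigr => j _ do rewrite -mulr_sumr.
rewrite -mulr_sumr -mulrA /=; congr (_ * _).
rewrite totalS -/I'.
move: (total_state I') (I ord_max) => t i; clear - q_neq0.
rewrite !big_ord_recl !big_ord0 /bump /h_factor /column_factor /=.
have expE m k : q ^+ (2 * (m + k)) = (q ^+ m * q ^+ k) ^+ 2.
  by rewrite -exprD mulnC exprM.
have exp2E m : q ^+ (2 * m) = (q ^+ m) ^+ 2 by rewrite mulnC exprM.
have expNE m : (- q) ^+ m = (-1) ^+ m * q ^+ m by exact: exprNn.
rewrite -[N.+1]addn1 !(expE, exp2E, expNE, exprD, expr1).
have: q ^+ t != 0 by rewrite expf_neq0.
have: q ^+ N != 0 by rewrite expf_neq0.
(* The identities are rational in q, q^t and q^N, once the sign (-1)^t has been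
   fixed by the parity of t. *)
rewrite -(signr_odd _ t); move: (q ^+ t) (q ^+ N) (odd t).
move=> Y X b X_neq0 Y_neq0.
case: i => -[|[|[|//]]] ?; case: s => -[|[|[|//]]] ? /=;
  case: b => /=; rewrite ?expr0 ?expr1; field;
  by rewrite q_neq0 X_neq0 Y_neq0 /= ?oppr_eq0 ?expf_neq0 ?mulf_neq0.
Qed.

Lemma total_twos N : total_state (fun _ : 'I_N => ord_max : 'I_3) = (2 * N)%N.
Proof. by rewrite /total_state sum_nat_const card_ord mulnC. Qed.

Lemma total_eq_twos N (I : {ffun 'I_N -> 'I_3}) :
  (total_state I == 2 * N)%N = (I == [ffun=> ord_max]).
Proof.
rewrite -total_twos; have /leqif_sum [_ ->] : forall r : 'I_N, true ->
    (I r <= (ord_max : 'I_3) ?= iff (I r == ord_max))%N.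
  by move=> r _; split; [rewrite -ltnS | rewrite val_eqE].
apply/forallP/eqP => [I2|-> r]; last by rewrite ffunE eqxx.
by apply/ffunP => r; rewrite ffunE; exact/eqP/I2.
Qed.

Lemma total_eq0 N (I : {ffun 'I_N -> 'I_3}) :
  (total_state I == 0)%N = (I == [ffun=> ord0]).
Proof.
rewrite sum_nat_eq0; apply/forallP/eqP => [I0|-> r]; last by rewrite ffunE.
by apply/ffunP => r; rewrite ffunE; apply/val_inj/eqP/I0.
Qed.

Lemma h_coef_const (C : fieldType) (q : C) N (j : 'I_3) :
  j != 1 :> nat -> h_coef q (fun _ : 'I_N => j) = 1.
Proof.
move=> j_neq1; rewrite /h_coef /count_ones /inversions big1 => [|r _].
  rewrite big1 ?invr1 ?mulr1 // => i _; apply: big1 => k _.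
  by case: j j_neq1 => -[|[|[|]]].
by rewrite (negbTE j_neq1).
Qed.

(** Lambda_m, the factor contributed by m columns at infinity with top states 2;
the index j starts at 0, and q * q^-(2 (j + 1)) is p^(2 (j + 1) - 1). *)
Definition twos_factor (C : fieldType) (q : C) (m : nat) : C :=
  \prod_(j < m) ((1 - q ^- (2 * j.+1)) * (1 + q * q ^- (2 * j.+1))).

Lemma twos_factor_neq0 (C : fieldType) (q : C) m :
  q != 0 -> (forall m : nat, (0 < m)%N -> q ^+ m != 1) -> twos_factor q m != 0.
Proof.
move=> q_neq0 q_generic; apply/prodf_neq0 => j _; apply: mulf_neq0.
  rewrite subr_eq0 eq_sym; apply: contra_neq (q_generic (2 * j.+1)%N isT).
  by move=> /(congr1 GRing.inv); rewrite invrK invr1.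
rewrite mulnS exprS invfM mulVKf // addrC addr_eq0.
apply: contra_neqN (q_generic (2 * (2 * j).+1)%N isT) => /eqP eqN1.
by rewrite mulnC exprM -[q ^+ _]invrK eqN1 invrN1 sqrrN expr1n.
Qed.

(** The first m columns, with top states 2, starting from the left boundary
(2^N). The states I leaving them satisfy |I| = 2 (N - m). *)
Lemma path_sum_inf_column (C : fieldType) (q : C) N m
    (I : {ffun 'I_N -> 'I_3}) : q != 0 ->
  path_sum (fun _ : 'I_m => inf_column q ord_max) [ffun=> ord_max] I =
  (twos_factor q m * h_coef q I) *+ (total_state I + 2 * m == 2 * N)%N.
Proof.
move=> q_neq0; elim: m I => [|m IHm] I.
  rewrite path_sum0 muln0 addn0 total_eq_twos eq_sym.
  rewrite /twos_factor big_ord0 mul1r.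
  case: eqP => //= ->; rewrite -(@h_coef_const _ q N ord_max) //.
  by congr h_coef; apply/funext => r; rewrite ffunE.
rewrite path_sumS /twos_factor big_ord_recr /= -/(twos_factor q m).
have stepE (J : {ffun 'I_N -> 'I_3}) :
    (twos_factor q m * h_coef q J) *+ (total_state J + 2 * m == 2 * N)%N
      * inf_column q ord_max J I =
    twos_factor q m *+ (total_state I + 2 * m.+1 == 2 * N)%N *
      (h_coef q J * inf_column q ord_max J I).
  have [->|/inf_column_conserve ->] :=
    eqVneq (total_state J) (total_state I + (ord_max : 'I_3))%N.
    by rewrite -addnA -mulnS -mulrnAl mulrA.
  by rewrite !mulr0.
under eq_bigr => J _ do rewrite IHm stepE.
rewrite -mulr_sumr sum_h_coef_inf_column //.
case: eqP => [tot|_]; last by rewrite !mul0r.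
rewrite !mulr1n mulrCA [RHS]mulrC; congr (_ * (_ * _)).
(* |I| is even, so that (-q)^|I| is q^|I| and e = q^-(2 (m + 1)). *)
have odd_t : odd (total_state I) = false.
  by have := congr1 odd tot; rewrite oddD !oddM /= addbF.
have expN : (- q) ^+ total_state I = q ^+ total_state I.
  by rewrite exprNn -signr_odd odd_t mul1r.
rewrite /column_factor /= expN.
by rewrite -tot exprD invfM mulVKf ?expf_neq0.
Qed.

(** * The limit of F *)

Lemma iterated_lim_path_sum (C : numFieldType) n (T : finType) L
    (M : n.-tuple C -> 'I_L -> T -> T -> C) (M' : 'I_L -> T -> T -> C) a b :
  (forall r c d, iterated_lim_infty (fun u => M u r c d) (M' r c d)) ->
  iterated_lim_infty (fun u => path_sum (M u) a b) (path_sum M' a b).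
Proof.
move=> limM; apply: iterated_lim_big => [*|v _]; first exact: iterated_limD.
by apply: iterated_lim_big => [*|r _]; [exact: iterated_limM | exact: limM].
Qed.

Lemma lim_F_fun (C : numFieldType) (q : C) n N (S : two_string)
    (x : 'I_N -> C) (z : nat -> C) :
  q != 0 -> (str_weight S + 2 * n = 2 * N)%N ->
  iterated_lim_infty
    (fun u : n.-tuple C => F_fun q (cat_twos n S) x (cat_alphabet u z))
    (twos_factor q n * H_fun q S x z).
Proof.
move=> q_neq0 weightS.
pose W c : {ffun 'I_N -> 'I_3} -> {ffun 'I_N -> 'I_3} -> C :=
  column_sum (fun r => if (c < n)%N then ik_weight q 0 1
                       else ik_weight q (x r) (z (c - n)%N)) (cat_twos n S c).
have -> : twos_factor q n * H_fun q S x z =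
    path_sum (fun c : 'I_(n + str_len S) => W c) [ffun=> ord_max] [ffun=> ord0].
  rewrite path_sum_cat /H_fun big_distrr [LHS]big_mkcond /=.
  apply: eq_bigr => I _; rewrite -/(h_coef q I) -/(total_state I).
  rewrite (@eq_path_sum _ _ n _ (fun=> inf_column q ord_max)); last first.
    by move=> r c d; rewrite /W ltn_ord cat_twosE ltn_ord.
  rewrite path_sum_inf_column // -weightS eqn_add2r.
  case: eqP => _; last by rewrite mul0r.
  rewrite mulr1n mulrA; congr (_ * _).
  rewrite partition_fun_path_sum; congr (path_sum _ _ _); last first.
    by apply/ffunP => r; rewrite ffunE.
  by apply/funext => c; rewrite /W cat_twosE ltnNge leq_addr addKn.
rewrite (_ : (fun u => _) = fun u : n.-tuple C =>
    path_sum (fun c : 'I_(n + str_len S) =>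
      column_sum (fun r => ik_weight q (x r) (cat_alphabet u z c))
        (cat_twos n S c))
    [ffun=> ord_max] [ffun=> ord0]); last first.
  by apply/funext => u; rewrite /F_fun partition_fun_path_sum str_len_cat_twos.
apply: iterated_lim_path_sum => c J I; apply: iterated_lim_path_sum => r a b.
rewrite /cat_alphabet; case: ltnP => [ltcn|lenc].
  apply: (iterated_lim_nth (phi := fun y => ik_weight q (x r) y _ _ _ _)) => //.
  exact: cvg_ik_weight.
under eq_fun => u do rewrite nth_default ?size_tuple //.
exact: iterated_lim_cst.
Qed.

(** For S empty only I = (0^N) contributes, and there are no columns. *)
Lemma H_fun_empty (C : fieldType) (q : C) N (x : 'I_N -> C) (z : nat -> C) :
  H_fun q empty_string x z = 1.
Proof.
rewrite /H_fun str_weight_empty (big_pred1 [ffun=> ord0]) => [|I]; last first.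
  by rewrite -[RHS]total_eq0.
have -> : [ffun=> ord0] = (fun=> ord0) :> ('I_N -> 'I_3).
  by apply/funext => r; rewrite ffunE.
rewrite -/(h_coef q _) h_coef_const // mul1r partition_fun_path_sum.
by rewrite str_len_empty path_sum0 (_ : _ == _) //; apply/eqP/ffunP => r.
Qed.

Theorem theorem1p7p2 (C : numFieldType) (q : C) (K N : nat) (S : two_string)
    (x : 'I_N -> C) (z : nat -> C) (w : 'I_(N - K) -> C)
    (ltKN : (K < N)%N)
    (weightS : str_weight S = (2 * K)%N)
    (q_neq0 : q != 0)
    (q_generic : forall m : nat, (0 < m)%N -> q ^+ m != 1)
    (xz_generic : forall (r : 'I_N) (c : nat),
       x r - q ^+ 2 * z c != 0 /\ x r - q ^+ 3 * z c != 0) :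
  iterated_lim_infty
    (fun u : (N - K).-tuple C =>
       F_fun q (cat_twos (N - K) S) x (cat_alphabet u z)
       / F_fun q (cat_twos (N - K) empty_string) w (nth 0 u))
    (H_fun q S x z).
Proof.
have Lambda_neq0 := twos_factor_neq0 (N - K) q_neq0 q_generic.
have lim_num := lim_F_fun x z q_neq0 (S := S).
have lim_den := lim_F_fun w (fun=> 0) q_neq0 (S := empty_string).
rewrite -[H_fun _ _ _ _](mulKf Lambda_neq0) mulrC.
apply: iterated_limM.
  by apply: lim_num; rewrite weightS -mulnDr subnKC // ltnW.
apply: iterated_limV => //; rewrite -[twos_factor q _]mulr1.
rewrite -(H_fun_empty q w (fun=> 0)); apply: lim_den.
by rewrite str_weight_empty.
Qed.
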